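(* Let $d\ge 1$ and let $f\colon[0,\infty)\to\mathbb{R}$ be an admissible kernel profile in dimension $d$, with associated multiscale kernel $K$ on $\mathbb{R}^d$. Suppose that $f$ is differentiable and that there exists a constant $A_1>0$ such that $r^{3/2}|f'(r)|\le A_1$ for all $r\ge 0$. Then there is a constant $A_f>0$, depending only on $f$, such that $$\sup_{x\in\mathbb{R}^d}\left\|\Sigma_\alpha(x,\sigma)-\Sigma_\beta(x,\sigma)\right\|\le\frac{\sigma A_f}{C_d(\sigma)}\,W_1(\alpha,\beta)$$ for any $\alpha,\beta\in\mathcal{P}_1(\mathbb{R}^d)$ and any $\sigma>0$.
   Context: An admissible kernel profile in dimension $d$ is a bounded measurable function $f\colon[0,\infty)\to\mathbb{R}$ such that (a) $f(r)\ge 0$ for all $r$; (b) $M_d=\int_0^\infty r^{\frac d2-1}f(r)\,dr<\infty$; (c) there is $C>0$ with $rf(r)\le C$ for all $r\ge0$; normalized so that $\sup f=1$. The associated multiscale kernel is $K(x,y,\sigma)=\frac{1}{C_d(\sigma)}f\!\left(\frac{\|y-x\|^2}{\sigma^2}\right)$, $x,y\in\mathbb{R}^d$, $\sigma>0$, where $C_d(\sigma)=\frac12\sigma^dM_d\,\omega_{d-1}$ and $\omega_{d-1}=2\pi^{d/2}/\Gamma(d/2)$ is the surface area of the unit sphere in $\mathbb{R}^d$. For a Borel probability measure $\alpha$ on $\mathbb{R}^d$, the multiscale covariance tensor field is $\Sigma_\alpha(x,\sigma)=\int_{\mathbb{R}^d}(y-x)\otimes(y-x)K(x,y,\sigma)\,\alpha(dy)\in\mathbb{R}^d\otimes\mathbb{R}^d$.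 Identifying $x\otimes y$ with the matrix $xy^T$, $\|\cdot\|$ on $\mathbb{R}^d\otimes\mathbb{R}^d$ is the Frobenius norm. $\mathcal{P}_1(\mathbb{R}^d)$ is the set of Borel probability measures with finite first moment, and $W_1$ is the 1-Wasserstein distance for the Euclidean metric. *)

(* Defs.v *)
From HB Require Import structures.
From mathcomp Require Import all_boot all_order all_algebra.
From mathcomp Require Import all_classical all_reals all_analysis.

Set Implicit Arguments.
Unset Strict Implicit.
Unset Printing Implicit Defensive.

Import Order.TTheory GRing.Theory Num.Theory.
Import numFieldNormedType.Exports.

Local Open Scope classical_set_scope.
Local Open Scope ring_scope.

(* R^d is the type of column vectors with its Borel sigma-algebra.  The library
   topology comes from the sup norm, so its open sets are the Euclidean ones. *)
Notation euclid R d := (g_sigma_algebraType (@open 'cV[R]_d)).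

(* Frobenius norm; on column vectors (n = 1) this is the Euclidean norm.  The
   library norm on matrices is the sup norm, hence not the one wanted here. *)
Definition frob {R : realType} {m n : nat} (A : 'M[R]_(m, n)) : R :=
  Num.sqrt (\sum_(i < m) \sum_(j < n) A i j ^+ 2).

Section Profile.
Context {R : realType}.

(* A function on [0, +oo[ is represented by f : R -> R; only the values on
   [0, +oo[ are ever used.  At r = 0 the limit below is the right derivative. *)
Definition halfline_quotients (f : R -> R) (r : R) : set_system R :=
  (fun h => h^-1 * (f (r + h) - f r)) @ within [set h | 0 <= r + h] 0^'.

Definition halfline_derivable (f : R -> R) (r : R) : Prop :=
  cvg (halfline_quotients f r).

Definition halfline_derive (f : R -> R) (r : R) : R :=
  lim (halfline_quotients f r).

(* For d = 1 the library sets 0 `^ (-1/2) = 0; this affects a null set only. *)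
Definition profile_moment (d : nat) (f : R -> R) : \bar R :=
  (\int[lebesgue_measure]_(r in `[0%R, +oo[) (r `^ (d%:R / 2 - 1) * f r)%:E)%E.

Record admissible (d : nat) (f : R -> R) : Prop := Admissible {
  adm_bounded : exists B : R, forall r : R, 0 <= r -> `|f r| <= B ;
  adm_measurable : measurable_fun (`[0%R, +oo[ : set R) f ;
  adm_ge0 : forall r : R, 0 <= r -> 0 <= f r ;
  adm_moment : (profile_moment d f < +oo)%E ;
  adm_decay : exists2 C : R, 0 < C & forall r : R, 0 <= r -> r * f r <= C ;
  adm_sup : sup (f @` `[0%R, +oo[) = 1 }.

Definition euler_gamma (s : R) : R :=
  \int[lebesgue_measure]_(t in `]0, +oo[) (t `^ (s - 1) * expR (- t)).

Definition sphere_area (d : nat) : R :=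
  2 * pi `^ (d%:R / 2) / euler_gamma (d%:R / 2).

Definition Cd (d : nat) (f : R -> R) (sigma : R) : R :=
  2^-1 * sigma ^+ d * fine (profile_moment d f) * sphere_area d.

Definition mskernel (d : nat) (f : R -> R) (x y : 'cV[R]_d) (sigma : R) : R :=
  (Cd d f sigma)^-1 * f (frob (y - x) ^+ 2 / sigma ^+ 2).

End Profile.

Section Tensor.
Context {R : realType} {d : nat}.

Definition tensor (x y : 'cV[R]_d) : 'M[R]_d := x *m y^T.

Definition cov_tensor (f : R -> R) (alpha : probability (euclid R d) R)
    (x : 'cV[R]_d) (sigma : R) : 'M[R]_d :=
  \matrix_(i, j) \int[alpha]_(y in setT)
    (tensor ((y : 'cV[R]_d) - x) (y - x) i j * mskernel f x y sigma).

Definition finite_first_moment (alpha : probability (euclid R d) R) : Prop :=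
  (\int[alpha]_y (frob (y : 'cV[R]_d))%:E < +oo)%E.

Definition coupling (alpha beta : probability (euclid R d) R)
    (p : probability (euclid R d * euclid R d)%type R) : Prop :=
  forall A : set (euclid R d), measurable A ->
    p (A `*` setT) = alpha A /\ p (setT `*` A) = beta A.

Definition W1 (alpha beta : probability (euclid R d) R) : \bar R :=
  ereal_inf [set (\int[p]_z (frob ((z.1 : 'cV[R]_d) - z.2))%:E)%E
            | p in coupling alpha beta].

End Tensor.

(* Main.v *)
(* The map [v |-> f (|v|^2 / s^2) v v^T] is Lipschitz for the Frobenius norm with
   constant [s * Af].  After rescaling to [s = 1], and for |w| <= |u|, write
   [f(|u|^2) u u^T - f(|w|^2) w w^T] as
   [f(|u|^2) (u u^T - w w^T) + (f(|u|^2) - f(|w|^2)) w w^T]: the first term is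
   controlled by [|u| f(|u|^2) <= 1 + C], the second by the mean value theorem
   for [t |-> f(t^2)] on [|w|, |u|] and the hypothesis on [r^(3/2) |f'(r)|].
   Integrating this estimate against a coupling of [alpha] and [beta] bounds the
   difference of the tensors by the transport cost, and one takes the infimum. *)
Require Import Defs.
From HB Require Import structures.
From mathcomp Require Import all_boot all_order all_algebra.
From mathcomp Require Import all_classical all_reals all_analysis.
From mathcomp Require Import measurable_realfun ring lra.

Set Implicit Arguments.
Unset Strict Implicit.
Unset Printing Implicit Defensive.

Import Order.TTheory GRing.Theory Num.Theory.
Import numFieldNormedType.Exports.

Local Open Scope classical_set_scope.
Local Open Scope ring_scope.

(** * The Frobenius norm *)

Lemma coordB {V : zmodType} m n (A B : 'M[V]_(m, n)) i j :
  (A - B) i j = A i j - B i j.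
Proof. by rewrite !mxE. Qed.

Section Frobenius.
Context {R : realType} {m n : nat}.
Implicit Types A B : 'M[R]_(m, n).

Lemma frob_ge0 A : 0 <= frob A.
Proof. exact: sqrtr_ge0. Qed.

Lemma sqr_frob A : frob A ^+ 2 = \sum_i \sum_j A i j ^+ 2.
Proof.
by rewrite sqr_sqrtr//; apply: sumr_ge0 => i _; apply: sumr_ge0 => j _; exact: sqr_ge0.
Qed.

Lemma frob0 : frob (0 : 'M[R]_(m, n)) = 0.
Proof.
rewrite /frob big1 ?sqrtr0// => i _; rewrite big1// => j _.
by rewrite mxE expr0n.
Qed.

Lemma frob_coord A i j : `|A i j| <= frob A.
Proof.
rewrite -ler_sqr ?nnegrE ?frob_ge0// sqr_frob (bigD1 i)//= (bigD1 j)//= real_normK ?num_real//.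
rewrite -addrA lerDl addr_ge0//; first by apply: sumr_ge0 => ? _; exact: sqr_ge0.
by apply: sumr_ge0 => ? _; apply: sumr_ge0 => ? _; exact: sqr_ge0.
Qed.

Lemma frob_eq0 A : frob A = 0 -> A = 0.
Proof.
move=> A0; apply/matrixP => i j; rewrite mxE; apply/eqP; rewrite -normr_le0 -A0.
exact: frob_coord.
Qed.

Lemma frobZ c A : frob (c *: A) = `|c| * frob A.
Proof.
rewrite /frob -sqrtr_sqr -sqrtrM ?sqr_ge0//; congr Num.sqrt.
rewrite mulr_sumr; apply: eq_bigr => i _; rewrite mulr_sumr; apply: eq_bigr => j _.
by rewrite mxE exprMn.
Qed.

Lemma frobN A : frob (- A) = frob A.
Proof. by rewrite -scaleN1r frobZ normrN1 mul1r. Qed.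

(** Cauchy-Schwarz: with [a], [b] the two norms and [D] the pairing, the squared norm of [b A - a B]
    expands to [2 a b (a b - D)]. Matrices of norm zero are treated first, so that [2 a b] can be
    cancelled. *)
Lemma frob_dot_le A B : \sum_i \sum_j A i j * B i j <= frob A * frob B.
Proof.
set D := (X in X <= _); set a := frob A; set b := frob B.
have [A0|A_gt0] := leP a 0.
  have /frob_eq0 A0' : a = 0 by apply/eqP; rewrite eq_le A0 frob_ge0.
  rewrite /D big1 ?mulr_ge0 ?frob_ge0// => i _; rewrite big1// => j _.
  by rewrite A0' mxE mul0r.
have [B0|B_gt0] := leP b 0.
  have /frob_eq0 B0' : b = 0 by apply/eqP; rewrite eq_le B0 frob_ge0.
  rewrite /D big1 ?mulr_ge0 ?frob_ge0// => i _; rewrite big1// => j _.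
  by rewrite B0' mxE mulr0.
have : 0 <= \sum_i \sum_j (b * A i j - a * B i j) ^+ 2.
  by apply: sumr_ge0 => i _; apply: sumr_ge0 => j _; exact: sqr_ge0.
have -> : \sum_i \sum_j (b * A i j - a * B i j) ^+ 2 =
    b ^+ 2 * (\sum_i \sum_j A i j ^+ 2) - 2 * (a * b) * D
    + a ^+ 2 * (\sum_i \sum_j B i j ^+ 2).
  rewrite -!mulNr !mulr_sumr -!big_split/=.
  apply: eq_bigr => i _; rewrite !mulr_sumr -!big_split/=; apply: eq_bigr => j _.
  ring.
rewrite -!sqr_frob -/a -/b.
have -> : b ^+ 2 * a ^+ 2 - 2 * (a * b) * D + a ^+ 2 * b ^+ 2 =
  (2 * (a * b)) * (a * b - D) by ring.
by rewrite pmulr_rge0 ?mulr_gt0// subr_ge0.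
Qed.

Lemma ler_frobD A B : frob (A + B) <= frob A + frob B.
Proof.
rewrite -ler_sqr ?nnegrE ?addr_ge0 ?frob_ge0//.
have -> : frob (A + B) ^+ 2 =
    frob A ^+ 2 + 2 * (\sum_i \sum_j A i j * B i j) + frob B ^+ 2.
  rewrite !sqr_frob mulr_sumr -!big_split/=; apply: eq_bigr => i _.
  rewrite mulr_sumr -!big_split/=; apply: eq_bigr => j _.
  rewrite mxE; ring.
by have := frob_dot_le A B; nra.
Qed.

Lemma ler_frob_dist A B : `|frob A - frob B| <= frob (A - B).
Proof.
have h1 := ler_frobD (A - B) B.
have h2 := ler_frobD (B - A) A.
rewrite !subrK in h1 h2.
by rewrite ler_norml; rewrite -(opprB A B) frobN in h2; apply/andP; split; lra.
Qed.

End Frobenius.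

Lemma frob_tensor {R : realType} d (u v : 'cV[R]_d) :
  frob (tensor u v) = frob u * frob v.
Proof.
apply/eqP; rewrite -(eqrXn2 (n := 2))// ?mulr_ge0 ?frob_ge0// exprMn !sqr_frob.
apply/eqP; rewrite mulr_suml; apply: eq_bigr => i _; rewrite big_ord1.
rewrite mulr_sumr; apply: eq_bigr => j _.
by rewrite big_ord1 !mxE big_ord1 !mxE exprMn.
Qed.

(** * Lipschitz estimates for the profile and the rescaled tensor *)

Section Profile.
Context {R : realType}.
Implicit Types f : R -> R.

(** Away from the endpoint the constraint [0 <= r + h] holds for all small [h], so the one-sided
    notion agrees with ordinary differentiability. *)
Lemma halfline_quotientsE f r : 0 < r ->
  halfline_quotients f r = (fun h => h^-1 *: (f (h + r) - f r)) @ 0^'.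
Proof.
move=> r0.
have in0 : \forall h \near (0 : R)^', 0 <= r + h.
  near=> h.
  rewrite -lerBlDl sub0r.
  have : `|h| < r by near: h; exact: dnbhs0_lt.
  by rewrite ltr_norml => /andP[/ltW].
rewrite /halfline_quotients; apply/seteqP; split => A /=; rewrite !nbhs_simpl/= => HA.
- have : \forall h \near (0 : R)^', 0 <= r + h -> A (h^-1 * (f (r + h) - f r)) by exact: HA.
  by apply: filterS2 in0 => h /[swap] /[apply]; rewrite (addrC r).
- suff : \forall h \near (0 : R)^', 0 <= r + h -> A (h^-1 * (f (r + h) - f r)) by exact.
  have : \forall h \near (0 : R)^', A (h^-1 *: (f (h + r) - f r)) by exact: HA.
  by apply: filterS => h; rewrite (addrC r).
Unshelve. all: by end_near.
Qed.

Lemma halfline_is_derive f r : 0 < r -> halfline_derivable f r ->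
  is_derive r 1 f (halfline_derive f r).
Proof.
move=> r0; rewrite /halfline_derivable /halfline_derive halfline_quotientsE// => fr.
have df : derivable f r 1.
  rewrite /derivable /=; under eq_fun do rewrite [_ *: 1]mulr1; exact: fr.
by apply: DeriveDef => //; rewrite -derive1E.
Qed.

(** Turns the derivative hypothesis at [r = t ^+ 2] into a bound on [t ^+ 3] times the derivative
    there. *)
Lemma powR3half (t : R) : 0 <= t -> (t ^+ 2) `^ (3 / 2) = t ^+ 3.
Proof.
move=> t0; rewrite -powR_mulrn// -powRrM -powR_mulrn//; congr (_ `^ _).
by field.
Qed.

Context (f : R -> R) (C A1 : R).
Hypothesis f_diff : forall r : R, 0 <= r -> halfline_derivable f r.
Hypothesis f_bound : forall r : R, 0 <= r -> r `^ (3 / 2) * `|halfline_derive f r| <= A1.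
Hypothesis f_ge0 : forall r : R, 0 <= r -> 0 <= f r.
Hypothesis f_le1 : forall r : R, 0 <= r -> f r <= 1.
Hypothesis f_decay : forall r : R, 0 <= r -> r * f r <= C.

(* The derivative of [t |-> f (t ^+ 2)] at [t > 0] has modulus at most
   [2 * A1 / t ^+ 2]. *)
Lemma profile_dist_le (a b : R) : 0 <= b -> b <= a ->
  b ^+ 2 * `|f (a ^+ 2) - f (b ^+ 2)| <= 2 * A1 * (a - b).
Proof.
move=> b0; rewrite le_eqVlt => /predU1P[->|ba].
  by rewrite !subrr normr0 !mulr0.
(* The chain rule below is available only at positive [t]; for [b = 0] the factor [b ^+ 2] makes the
   left side vanish. *)
move: b0; rewrite le_eqVlt => /predU1P[b0|b0].
  have A1_ge0 : 0 <= A1 by apply: le_trans (f_bound ler01); rewrite mulr_ge0 ?powR_ge0.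
  by rewrite -b0 expr0n mul0r !mulr_ge0 ?subr_ge0//; lra.
pose g t := f (t ^+ 2).
have dg (t : R) : 0 < t -> is_derive t 1 g (halfline_derive f (t ^+ 2) * (2 * t)).
  move=> t0; apply: (@is_derive1_comp _ f (fun t => t ^+ 2)).
    by apply: halfline_is_derive; [rewrite exprn_gt0|apply: f_diff; rewrite sqr_ge0].
  have := is_deriveX 2 (is_derive_id t (1 : R)).
  by rewrite expr1 [_ *: 1]mulr1.
have [t||c /andP[]] := @MVT R g (fun t => halfline_derive f (t ^+ 2) * (2 * t)) b a ba.
- by rewrite in_itv/= => /andP[bt _]; apply: dg; exact: lt_trans bt.
- apply: derivable_within_continuous => t; rewrite in_itv/= => /andP[bt _].
  by have [] := dg t (lt_le_trans b0 bt).
rewrite !bnd_simp => bc ca; rewrite /g => ->.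
have c0 : 0 < c by exact: lt_trans bc.
have := f_bound (sqr_ge0 c); rewrite powR3half ?(ltW c0)//.
rewrite !normrM (gtr0_norm c0) (ger0_norm (ler0n _ 2)) [`|a - b|]gtr0_norm ?subr_gt0//.
set D := `|_| => h.
have D0 : 0 <= D by exact: normr_ge0.
(* Replacing [b ^+ 2] by the larger [c ^+ 2] completes the chain-rule factor [2 c] to [2 c ^+ 3],
   which [h] controls. *)
have b2c2 : b ^+ 2 <= c ^+ 2 by rewrite ler_sqr ?nnegrE ltW.
apply: (@le_trans _ _ (c ^+ 2 * (D * (2 * c) * (a - b)))).
  by rewrite ler_wpM2r// !mulr_ge0// ?(ltW c0)// subr_ge0 ltW.
have -> : c ^+ 2 * (D * (2 * c) * (a - b)) = 2 * (c ^+ 3 * D) * (a - b) by ring.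
by rewrite ler_wpM2r ?subr_ge0 ?(ltW ba)// ler_pM2l.
Qed.

(** Since [a <= 1 + a ^+ 2], the bound [f <= 1] handles the first summand and the decay of [f] the
    second. *)
Lemma profile_mul_le (a : R) : 0 <= a -> a * f (a ^+ 2) <= 1 + C.
Proof.
move=> a0; have f0 := f_ge0 (sqr_ge0 a); have f1 := f_le1 (sqr_ge0 a).
have fC := f_decay (sqr_ge0 a).
have C0 : 0 <= C by apply: le_trans (f_decay (lexx 0)); rewrite mul0r.
have := sqr_ge0 (a - 1); nra.
Qed.

Context {d : nat}.
Implicit Types u w : 'cV[R]_d.

Lemma tensor_dist_le u w :
  frob (tensor u u - tensor w w) <= (frob u + frob w) * frob (u - w).
Proof.
have -> : tensor u u - tensor w w = tensor u (u - w) + tensor (u - w) w.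
  by rewrite /tensor linearB/= mulmxBr mulmxBl addrA subrK.
by apply: le_trans (ler_frobD _ _) _; rewrite !frob_tensor mulrDl (mulrC (frob w)).
Qed.

Lemma profile_tensor_lipschitz u w :
  frob (f (frob u ^+ 2) *: tensor u u - f (frob w ^+ 2) *: tensor w w)
  <= (2 * (1 + C) + 2 * A1) * frob (u - w).
Proof.
(* The larger norm must sit in the profile value that multiplies the tensor difference, and the
   smaller one in the squared factor of [profile_dist_le]. *)
wlog wu : u w / frob w <= frob u => [hwlog|].
  have /orP[|wu] := le_total (frob w) (frob u); first exact: hwlog.
  by rewrite -frobN opprB -(frobN (u - w)) opprB; exact: hwlog.
set a := frob u; set b := frob w.
have -> : f (a ^+ 2) *: tensor u u - f (b ^+ 2) *: tensor w w =
    f (a ^+ 2) *: (tensor u u - tensor w w) +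
    (f (a ^+ 2) - f (b ^+ 2)) *: tensor w w.
  by rewrite scalerBr scalerBl addrA subrK.
have ab : a - b <= frob (u - w) by exact: le_trans (ler_norm _) (ler_frob_dist _ _).
apply: le_trans (ler_frobD _ _) _; rewrite !frobZ frob_tensor mulrDl lerD//.
- have f0 := f_ge0 (sqr_ge0 a); rewrite (ger0_norm f0).
  apply: (@le_trans _ _ (f (a ^+ 2) * ((a + a) * frob (u - w)))).
    rewrite ler_wpM2l//; apply: le_trans (tensor_dist_le _ _) _.
    (* The smaller norm is raised to [a], so that [f (a ^+ 2)] meets only [a] and [profile_mul_le]
       applies. *)
    by rewrite ler_wpM2r ?frob_ge0// lerD2l.
  rewrite mulrA ler_wpM2r ?frob_ge0//.
  by have := profile_mul_le (frob_ge0 u); rewrite -/a; lra.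
- rewrite -expr2 mulrC.
  apply: le_trans (profile_dist_le (frob_ge0 w) wu) _.
  have A1_ge0 : 0 <= A1 by apply: le_trans (f_bound ler01); rewrite mulr_ge0 ?powR_ge0.
  by rewrite ler_wpM2l// mulr_ge0.
Qed.

(** The tensor is quadratic, so passing to [s^-1 *: v] costs a factor [s ^+ 2], while the distance
    of the rescaled vectors returns [s^-1]; one factor [s] remains. *)
Lemma scaled_tensor_lipschitz (s : R) u w : 0 < s ->
  frob (f (frob u ^+ 2 / s ^+ 2) *: tensor u u
        - f (frob w ^+ 2 / s ^+ 2) *: tensor w w)
  <= s * (2 * (1 + C) + 2 * A1) * frob (u - w).
Proof.
move=> s0; have sn0 : s != 0 by rewrite gt_eqF.
have E (v : 'cV[R]_d) : f (frob v ^+ 2 / s ^+ 2) *: tensor v v =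
    s ^+ 2 *: (f (frob (s^-1 *: v) ^+ 2) *: tensor (s^-1 *: v) (s^-1 *: v)).
  rewrite frobZ ger0_norm ?invr_ge0 ?(ltW s0)// exprMn exprVn (mulrC (s ^- 2)).
  rewrite /tensor (_ : (s^-1 *: v)^T = s^-1 *: v^T); last exact: linearZ.
  rewrite -scalemxAr -scalemxAl !scalerA; congr (_ *: _).
  by field.
rewrite !E -scalerBr frobZ ger0_norm ?sqr_ge0//.
apply: le_trans (ler_wpM2l (sqr_ge0 s) (profile_tensor_lipschitz _ _)) _.
rewrite -scalerBr frobZ ger0_norm ?invr_ge0 ?(ltW s0)//.
by rewrite le_eqVlt; apply/orP; left; apply/eqP; field.
Qed.

End Profile.

(** * Measurability and integrals of matrix-valued maps *)

Lemma continuous_euclid_measurable {R : realType} d (h : 'cV[R]_d -> R) :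
  continuous h -> measurable_fun [set: euclid R d] (h : euclid R d -> R).
Proof.
move=> ch; apply: (measurability _ (RGenOInfty.measurableE R)).
move=> _ [_ [a ->]] <-; rewrite setTI; apply: sub_sigma_algebra.
exact: open_comp.
Qed.

Lemma measurable_euclid_coord {R : realType} d (i : 'I_d) (j : 'I_1) :
  measurable_fun [set: euclid R d] (fun y : euclid R d => (y : 'cV[R]_d) i j).
Proof. by apply: continuous_euclid_measurable => y; exact: coord_continuous. Qed.

Lemma measurable_frob {R : realType} d0 (T : measurableType d0) m n
    (g : T -> 'M[R]_(m, n)) :
  (forall i j, measurable_fun [set: T] (fun t => g t i j)) ->
  measurable_fun [set: T] (fun t => frob (g t)).
Proof.
move=> mg; apply: (measurableT_comp (continuous_measurable_fun (@sqrt_continuous R))).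
apply: measurable_sum => i; apply: measurable_sum => j.
exact: measurable_funX.
Qed.

(** Pairing the integral [D] with itself writes its squared norm as the integral of the pairing of
    [D] with [M t]; Cauchy-Schwarz bounds this by [frob D] times the integral of [g], and one factor
    [frob D] cancels. *)
Lemma frob_Rintegral_le {R : realType} d0 (T : measurableType d0)
    (mu : {measure set T -> \bar R}) m n (M : T -> 'M[R]_(m, n)) (g : T -> R) :
  (forall i j, mu.-integrable setT (EFin \o (fun t => M t i j))) ->
  measurable_fun setT g -> (forall t, frob (M t) <= g t) ->
  ((frob (\matrix_(i, j) \int[mu]_t M t i j))%:E <= \int[mu]_t (g t)%:E)%E.
Proof.
move=> iM mg Mg; set D := \matrix_(i, j) _.
have g0 t : 0 <= g t by exact: le_trans (frob_ge0 _) (Mg t).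
have [D0|D_gt0] := leP (frob D) 0.
  apply: (@le_trans _ _ 0%E); first by rewrite lee_fin.
  by apply: integral_ge0 => t _; rewrite lee_fin.
have iDM i j : mu.-integrable setT (fun t => (D i j * M t i j)%:E).
  apply: (eq_integrable measurableT _ _ _ (integrableZl measurableT (D i j) (iM i j))) => t _ /=.
  by rewrite EFinM.
have iS i : mu.-integrable setT (fun t => \sum_j (D i j * M t i j)%:E)%E.
  exact: integrable_sum.
have E : ((frob D ^+ 2)%:E =
    \int[mu]_t (\sum_i \sum_j D i j * M t i j)%:E)%E.
  under eq_integral do (rewrite -sumEFin; under eq_bigr do rewrite -sumEFin).
  rewrite integral_sum// sqr_frob -sumEFin; apply: eq_bigr => i _.
  rewrite integral_sum// -sumEFin; apply: eq_bigr => j _.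
  under eq_integral do rewrite EFinM.
  rewrite integralZl//; last exact: iM.
  rewrite expr2 EFinM {2}/D mxE /Rintegral fineK//.
  by apply: integrable_fin_num => //; exact: iM.
rewrite -(@lee_pmul2l _ (frob D)%:E) ?lte_fin// -EFinM -expr2 E.
have iT : mu.-integrable setT (fun t => (\sum_i \sum_j D i j * M t i j)%:E).
  under eq_fun do (rewrite -sumEFin; under eq_bigr do rewrite -sumEFin).
  exact: integrable_sum.
have mT : measurable_fun setT (fun t => (\sum_i \sum_j D i j * M t i j)%:E).
  exact: measurable_int iT.
(* The pairing may change sign and the integral of [g] may be infinite; after taking absolute values
   only nonnegative integrands are compared. *)
apply: le_trans (lee_abs _) _.
apply: le_trans (le_abse_integral _ _ mT) _ => //.
rewrite -ge0_integralZl_EFin//; last 3 first.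
- by move=> t _; rewrite lee_fin.
- exact/measurable_EFinP.
- exact: frob_ge0.
apply: ge0_le_integral => //.
- exact: measurableT_comp.
- by apply/measurable_EFinP; apply: measurable_funM.
move=> t _; rewrite -EFinM abse_EFin lee_fin.
apply: (@le_trans _ _ (frob D * frob (M t))); last by rewrite ler_wpM2l// frob_ge0.
rewrite ler_norml frob_dot_le andbT lerNl.
have := frob_dot_le (- D) (M t); rewrite frobN; apply: le_trans.
rewrite -sumrN le_eqVlt; apply/orP; left; apply/eqP; apply: eq_bigr => i _.
by rewrite -sumrN; apply: eq_bigr => j _; rewrite [(- D) i j]mxE mulNr.
Qed.

(** * The unnormalized integrand of the covariance tensor *)

Section KernelTensor.
Context {R : realType} {d : nat} (f : R -> R) (C s : R).
Hypothesis mf : measurable_fun (`[0%R, +oo[ : set R) f.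
Hypothesis f_ge0 : forall r : R, 0 <= r -> 0 <= f r.
Hypothesis f_decay : forall r : R, 0 <= r -> r * f r <= C.
Hypothesis s_gt0 : 0 < s.

(** At [v = y - x] this is the integrand of [cov_tensor] without the factor [(Cd d f s)^-1]. *)
Definition kernel_tensor (v : 'cV[R]_d) : 'M[R]_d :=
  f (frob v ^+ 2 / s ^+ 2) *: tensor v v.

(** With [q = frob v ^+ 2 / s ^+ 2] the norm equals [s ^+ 2 * (q * f q)]. The bound is uniform in
    [v], which gives integrability against every probability measure. *)
Lemma frob_kernel_tensor_le v : frob (kernel_tensor v) <= s ^+ 2 * C.
Proof.
have q0 : 0 <= frob v ^+ 2 / s ^+ 2 by rewrite divr_ge0 ?sqr_ge0.
rewrite frobZ frob_tensor ger0_norm ?f_ge0// -expr2.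
rewrite -ler_pdivrMl ?exprn_gt0//; apply: le_trans (f_decay q0).
by rewrite le_eqVlt; apply/orP; left; apply/eqP; ring.
Qed.

Context d0 (T : measurableType d0) (P : probability T R) (g : T -> 'cV[R]_d).
Hypothesis mg : forall i j, measurable_fun [set: T] (fun t => g t i j).

Lemma measurable_kernel_tensor i j :
  measurable_fun [set: T] (fun t => kernel_tensor (g t) i j).
Proof.
have -> : (fun t => kernel_tensor (g t) i j) =
    (fun t => f (frob (g t) ^+ 2 / s ^+ 2)) \* ((fun t => g t i 0) \* (fun t => g t j 0)).
  by apply/funext => t /=; rewrite !mxE big_ord1 !mxE.
apply: measurable_funM; last exact: measurable_funM.
(* [f] is measurable on the half-line only, so the inner function must be shown to take values
   there. *)
apply: (measurable_comp _ _ mf) => //.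
- by move=> _ [t _ <-] /=; rewrite in_itv/= andbT divr_ge0 ?sqr_ge0.
- apply: measurable_funM => //; apply: measurable_funX; exact: measurable_frob.
Qed.

Lemma integrable_kernel_tensor i j :
  P.-integrable setT (EFin \o (fun t => kernel_tensor (g t) i j)).
Proof.
apply: measurable_bounded_integrable.
- exact: measurableT.
- exact: le_lt_trans (probability_le1 P measurableT) (ltry 1).
- exact: measurable_kernel_tensor.
rewrite /bounded_near; near=> M => t _ /=.
apply: (@le_trans _ _ (s ^+ 2 * C)); last by near: M; apply: nbhs_pinfty_ge; rewrite num_real.
by apply: le_trans (frob_coord _ _ _) _; exact: frob_kernel_tensor_le.
Unshelve. all: by end_near. Qed.

End KernelTensor.

(** * Couplings and the normalizing constant *)

(** The marginals of a coupling are its pushforwards under the two projections, so this is a change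
    of variables. *)
Lemma coupling_Rintegral {R : realType} d (alpha beta : probability (euclid R d) R)
    (p : probability (euclid R d * euclid R d)%type R) (h : euclid R d -> R) :
  coupling alpha beta p -> measurable_fun setT h ->
  p.-integrable setT (EFin \o (fun z => h z.1)) ->
  p.-integrable setT (EFin \o (fun z => h z.2)) ->
  \int[alpha]_y h y = \int[p]_z h z.1 /\ \int[beta]_y h y = \int[p]_z h z.2.
Proof.
move=> cp mh i1 i2; rewrite /Rintegral; split; congr fine.
- rewrite (@eq_measure_integral _ _ _ _ (pushforward p fst)); last first.
    move=> A mA _; have [E _] := cp A mA; apply: etrans (esym E) _.
    by congr (p _); apply/seteqP; split=> z //= -[].
  by rewrite integral_pushforward//; exact/measurable_EFinP.
- rewrite (@eq_measure_integral _ _ _ _ (pushforward p snd)); last first.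
    move=> A mA _; have [_ E] := cp A mA; apply: etrans (esym E) _.
    by congr (p _); apply/seteqP; split=> z //= -[].
  by rewrite integral_pushforward//; exact/measurable_EFinP.
Qed.

Lemma Cd_ge0 {R : realType} d (f : R -> R) s :
  (forall r : R, 0 <= r -> 0 <= f r) -> 0 <= s -> 0 <= Cd d f s.
Proof.
move=> f0 s0; rewrite /Cd !mulr_ge0 ?exprn_ge0//.
- apply: fine_ge0; apply: integral_ge0 => r /=; rewrite in_itv/= andbT => r0.
  by rewrite lee_fin mulr_ge0 ?powR_ge0// f0.
- exact: powR_ge0.
- rewrite invr_ge0; apply: Rintegral_ge0 => t _.
  by rewrite mulr_ge0 ?powR_ge0 ?expR_ge0.
Qed.

Lemma admissible_le1 {R : realType} d (f : R -> R) : admissible d f ->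
  forall r, 0 <= r -> f r <= 1.
Proof.
case=> -[B fB] _ _ _ _ <- r r0; apply: sup_upper_bound.
- split; first by exists (f r), r => //=; rewrite in_itv/= andbT.
  exists B => _ [t /andP[t0 _] <-].
  exact: le_trans (ler_norm _) (fB t t0).
- by exists r => //=; rewrite in_itv/= andbT.
Qed.

(** * Comparison of covariance tensors through a coupling *)

Section CovTensor.
Context {R : realType} {d : nat} (f : R -> R) (C A1 s : R).
Hypothesis f_diff : forall r : R, 0 <= r -> halfline_derivable f r.
Hypothesis f_bound : forall r : R, 0 <= r -> r `^ (3 / 2) * `|halfline_derive f r| <= A1.
Hypothesis f_adm : admissible d f.
Hypothesis f_decay : forall r : R, 0 <= r -> r * f r <= C.
Hypothesis s_gt0 : 0 < s.

Let f_ge0 := adm_ge0 f_adm.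
Let mf := adm_measurable f_adm.

Let measurable_shift d0 (T : measurableType d0) (x : 'cV[R]_d)
    (phi : T -> euclid R d) i j : measurable_fun setT phi ->
  measurable_fun [set: T] (fun t => ((phi t : 'cV[R]_d) - x) i j).
Proof.
move=> mphi.
have -> : (fun t => ((phi t : 'cV[R]_d) - x) i j) =
    (fun t => (phi t : 'cV[R]_d) i j) \- cst (x i j).
  by apply/funext => t; rewrite coordB.
apply: measurable_funB => //.
exact: (measurableT_comp (measurable_euclid_coord i j) mphi).
Qed.

Lemma cov_tensorE (alpha : probability (euclid R d) R) (x : 'cV[R]_d) :
  cov_tensor f alpha x s = (Cd d f s)^-1 *:
    \matrix_(i, j) \int[alpha]_y kernel_tensor f s ((y : 'cV[R]_d) - x) i j.
Proof.
apply/matrixP => i j; rewrite !mxE -RintegralZl//; last first.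
  apply: (integrable_kernel_tensor mf f_ge0 f_decay s_gt0) => k l.
  exact: (measurable_shift _ (phi := id)).
apply: eq_Rintegral => y _.
by rewrite /mskernel [kernel_tensor _ _ _ _ _]mxE mulrCA (mulrC (tensor _ _ _ _)).
Qed.

Lemma frob_cov_tensorB_le (alpha beta : probability (euclid R d) R) p x :
  coupling alpha beta p ->
  ((frob (cov_tensor f alpha x s - cov_tensor f beta x s))%:E
   <= (s * (2 * (1 + C) + 2 * A1) / Cd d f s)%:E
      * \int[p]_z (frob ((z.1 : 'cV[R]_d) - z.2))%:E)%E.
Proof.
move=> cp; set L := 2 * (1 + C) + 2 * A1.
pose K := kernel_tensor (d := d) f s.
have C_ge0 : 0 <= C by apply: le_trans (f_decay (lexx 0)); rewrite mul0r.
have A1_ge0 : 0 <= A1 by apply: le_trans (f_bound ler01); rewrite mulr_ge0 ?powR_ge0.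
have sL_ge0 : 0 <= s * L by rewrite mulr_ge0 ?(ltW s_gt0)// /L; lra.
have Cdi_ge0 : 0 <= (Cd d f s)^-1 by rewrite invr_ge0 Cd_ge0 ?(ltW s_gt0).
have iK (phi : euclid R d * euclid R d -> euclid R d) i j :
    measurable_fun setT phi ->
    p.-integrable setT (EFin \o (fun z => K ((phi z : 'cV[R]_d) - x) i j)).
  move=> mphi; apply: (integrable_kernel_tensor mf f_ge0 f_decay s_gt0) => k l.
  exact: measurable_shift.
have iK1 i j := iK fst i j measurable_fst.
have iK2 i j := iK snd i j measurable_snd.
(* Once both tensors are integrals against the same [p], their difference is a single integral. *)
have -> : cov_tensor f alpha x s - cov_tensor f beta x s = (Cd d f s)^-1 *:
    \matrix_(i, j) \int[p]_z (K ((z.1 : 'cV[R]_d) - x) - K ((z.2 : 'cV[R]_d) - x)) i j.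
  rewrite !cov_tensorE -scalerBr; congr (_ *: _); apply/matrixP => i j; rewrite !mxE.
  under [RHS]eq_Rintegral do rewrite coordB.
  have mK : measurable_fun [set: euclid R d] (fun y => K ((y : 'cV[R]_d) - x) i j).
    apply: (measurable_kernel_tensor s mf (g := fun y : euclid R d => (y : 'cV[R]_d) - x)) => k l.
    exact: (measurable_shift _ (phi := id)).
  have [-> ->] := coupling_Rintegral cp mK (iK1 i j) (iK2 i j).
  by rewrite RintegralB.
have mfrob : measurable_fun setT (fun z : euclid R d * euclid R d =>
    frob ((z.1 : 'cV[R]_d) - z.2)).
  apply: measurable_frob => i j.
  have -> : (fun z : euclid R d * euclid R d => ((z.1 : 'cV[R]_d) - z.2) i j) =
      (fun z => (z.1 : 'cV[R]_d) i j) \- (fun z => (z.2 : 'cV[R]_d) i j).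
    by apply/funext => z; rewrite coordB.
  apply: measurable_funB.
  - exact: (measurableT_comp (measurable_euclid_coord i j) measurable_fst).
  - exact: (measurableT_comp (measurable_euclid_coord i j) measurable_snd).
rewrite frobZ (ger0_norm Cdi_ge0) (mulrC (s * L)) !EFinM -muleA.
apply: lee_wpmul2l; first by rewrite lee_fin.
rewrite -EFinM -ge0_integralZl_EFin//; last 2 first.
- by move=> z _; rewrite lee_fin frob_ge0.
- exact/measurable_EFinP.
under [leRHS]eq_integral do rewrite -EFinM.
apply: frob_Rintegral_le.
- move=> i j.
  apply: (eq_integrable measurableT _ _ _ (integrableB measurableT (iK1 i j) (iK2 i j))) => z _ /=.
  by rewrite coordB EFinB.
- exact: measurable_funM.
move=> z.
(* The distance is invariant under translation by [x], hence the bound is uniform in [x]. *)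
have -> : (z.1 : 'cV[R]_d) - z.2 = (z.1 : 'cV[R]_d) - x - ((z.2 : 'cV[R]_d) - x).
  by rewrite opprB addrA subrK.
exact: (scaled_tensor_lipschitz f_diff f_bound f_ge0 (admissible_le1 f_adm) f_decay).
Qed.

End CovTensor.

Theorem theorem1 (R : realType) (f : R -> R)
    (f_diff : forall r : R, 0 <= r -> halfline_derivable f r)
    (f_bound : exists2 A1 : R, 0 < A1 &
       forall r : R, 0 <= r -> r `^ (3 / 2) * `|halfline_derive f r| <= A1) :
  exists2 Af : R, 0 < Af &
    forall d : nat, (1 <= d)%N -> admissible d f ->
    forall alpha beta : probability (euclid R d) R,
      finite_first_moment alpha -> finite_first_moment beta ->
    forall sigma : R, 0 < sigma ->
      (ereal_sup [set (frob (cov_tensor f alpha x sigma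
                             - cov_tensor f beta x sigma))%:E
                 | x in [set: 'cV[R]_d]]
       <= (sigma * Af / Cd d f sigma)%:E * W1 alpha beta)%E.
Proof.
have [A1 A1_gt0 fA1] := f_bound.
(* The decay bound of an admissible profile does not mention the dimension, so
   [Af] can be chosen before [d]. *)
have [[C C_gt0 fC]|nC] := pselect
    (exists2 C : R, 0 < C & forall r, 0 <= r -> r * f r <= C);
  (* Without such a [C] the profile is admissible in no dimension, and any positive constant
     serves. *)
  last by exists 1 => // d _ fadm; case: nC; exact: adm_decay fadm.
exists (2 * (1 + C) + 2 * A1) => [|d _ fadm alpha beta _ _ s s0]; first lra.
apply: ge_ereal_sup => _ [x _ <-].
(* If [Cd d f s] vanished, both sides would be [0] because [0^-1 = 0]. *)
have [Cd_le0|Cd_gt0] := leP (Cd d f s) 0.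
  have Cd0 : Cd d f s = 0.
    by apply/eqP; rewrite eq_le Cd_le0 Cd_ge0 ?(ltW s0)//; exact: adm_ge0 fadm.
  by rewrite !(cov_tensorE fadm fC s0) Cd0 invr0 !scale0r subrr frob0 mulr0 mul0e.
have c_gt0 : 0 < s * (2 * (1 + C) + 2 * A1) / Cd d f s.
  by rewrite divr_gt0// mulr_gt0//; lra.
(* Moving the positive factor to the other side leaves a lower bound for an infimum, which is
   checked one coupling at a time. *)
rewrite -lee_pdivrMl//; apply: le_ereal_inf_tmp => _ [p cp <-].
by rewrite lee_pdivrMl//; exact: frob_cov_tensorB_le.
Qed.
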